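(* The twist relation $\backsim$ on quantum spaces is an equivalence relation: it is reflexive, symmetric and transitive.
   Context: $\Bbbk$ is $\mathbb{R}$ or $\mathbb{C}$. A quantum space is a pair $\mathcal{A}=(\mathbf{A}_1,\mathbf{A})$ with $\mathbf{A}$ a unital associative $\Bbbk$-algebra generated by a finite-dimensional subspace $\mathbf{A}_1$; morphisms $(\mathbf{A}_1,\mathbf{A})\to(\mathbf{B}_1,\mathbf{B})$ are unital algebra maps sending $\mathbf{A}_1$ into $\mathbf{B}_1$; $\Pi:\mathbf{A}_1^\otimes\twoheadrightarrow\mathbf{A}$ is the canonical epimorphism from the tensor algebra. For a vector space $\mathbf{V}$, $\mathsf{C}^2[\mathbf{V}]$ is the group of linear automorphisms $\psi$ of $\mathbf{V}^\otimes\otimes\mathbf{V}^\otimes$ preserving each $\mathbf{V}^{\otimes r}\otimes\mathbf{V}^{\otimes s}$, with restrictions $\psi_{r,s}$. Identifying $\mathbf{V}^{\otimes r}\otimes\mathbf{V}^{\otimes s}\cong\mathbf{V}^{\otimes r+s}$ by multiplication, $\psi$ is a 2-cocycle if $\psi_{r+s,t}(\psi_{r,s}\otimes id_t)=\psi_{r,s+t}(id_r\otimes\psi_{s,t})$ for all $r,s,t$; counital if $\psi(1\otimes a)=1\otimes a$ and $\psi(a\otimes1)=a\otimes1$. $\mathfrak{Z}^2[\mathbf{V}]$ is the set of counital 2-cocycles. $\psi\in\mathsf{C}^2[\mathbf{A}_1]$ is $\mathcal{A}$-admissible if $\psi(\ker\Pi^{\otimes2})=\ker\Pi^{\otimes2}$.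 For $\mathcal{A}$-admissible $\psi\in\mathfrak{Z}^2[\mathbf{A}_1]$ the twisting $\mathcal{A}_\psi=(\mathbf{A}_1,\mathbf{A}_\psi)$ is the quantum space with $\mathbf{A}_\psi$ the vector space $\mathbf{A}$ with the same unit and product $m\,\Psi$, where $m$ is the product of $\mathbf{A}$ and $\Psi\,\Pi^{\otimes2}=\Pi^{\otimes2}\psi$. Two quantum spaces $\mathcal{A},\mathcal{B}$ are twist (or gauge) related, $\mathcal{A}\backsim\mathcal{B}$, if there exist an $\mathcal{A}$-admissible $\psi\in\mathfrak{Z}^2[\mathbf{A}_1]$ and an isomorphism of quantum spaces $\alpha:\mathcal{A}_\psi\simeq\mathcal{B}$. *)

(* Defs.v *)
From HB Require Import structures.
From mathcomp Require Import all_boot all_order all_algebra.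
From mathcomp Require Import boolp classical_sets reals.
From mathcomp Require Import generic_quotient ring_quotient.
From mathcomp Require Import finmap complex.
From mathcomp.multinomials Require Import monalg.

Set Implicit Arguments.
Unset Strict Implicit.
Unset Printing Implicit Defensive.

Import GRing.Theory.
Local Open Scope ring_scope.
Local Open Scope quotient_scope.
Local Open Scope classical_set_scope.

Section LinSpan.
Variables (k : fieldType) (M : lmodType k) (R : set M).

Definition lin_span : {pred M} := fun x =>
  `[< exists2 s : seq (k * M), (forall p, p \in s -> R p.2)
                             & x = \sum_(p <- s) p.1 *: p.2 >].

Lemma mem_lin_span x : R x -> x \in lin_span.
Proof.
move=> Rx; apply/asboolP; exists [:: (1, x)].
  by move=> p; rewrite inE => /eqP ->.
by rewrite big_seq1 scale1r.
Qed.

Lemma lin_span_closed : GRing.subsemimod_closed lin_span.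
Proof.
split; first split.
- by apply/asboolP; exists [::]; rewrite ?big_nil.
- move=> x y /asboolP[s sR ->] /asboolP[t tR ->]; apply/asboolP.
  exists (s ++ t); last by rewrite big_cat.
  by move=> p; rewrite mem_cat => /orP[/sR|/tR].
- move=> a x /asboolP[s sR ->]; apply/asboolP.
  exists [seq (a * p.1, p.2) | p <- s].
    by move=> p /mapP[q /sR Rq ->].
  by rewrite big_map scaler_sumr; apply: eq_bigr => p _; rewrite scalerA.
Qed.

HB.instance Definition _ := GRing.isSubmodClosed.Build k M lin_span lin_span_closed.

Lemma lin_span_ind (P : M -> Prop) :
    P 0 -> (forall x y, P x -> P y -> P (x + y)) ->
    (forall a x, R x -> P (a *: x)) -> forall x, x \in lin_span -> P x.
Proof.
move=> P0 PD PR x /asboolP[s sR ->]; rewrite big_seq.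
by elim/big_ind: _ => // p /sR; apply: PR.
Qed.

End LinSpan.

Definition lquot (k : fieldType) (M : lmodType k) (R : set M) :=
  Quotient.quot (lin_span R).
HB.instance Definition _ k M R := GRing.Zmodule.on (@lquot k M R).

Section LQuot.
Variables (k : fieldType) (M : lmodType k) (R : set M).

Definition lproj (x : M) : lquot R := \pi_(Quotient.quot (lin_span R)) x.
Definition lrepr (x : lquot R) : M := repr x.

Lemma lreprK : cancel lrepr lproj. Proof. exact: reprK. Qed.

Lemma lproj_eq x y : (lproj x = lproj y) <-> (x - y \in lin_span R).
Proof.
split=> [/eqP|]; first by rewrite /lproj piE Quotient.equivE.
by move=> h; apply/eqP; rewrite /lproj piE Quotient.equivE.
Qed.

Lemma lprojB : {morph lproj : x y / x - y}.
Proof. by move=> x y; rewrite /lproj !piE. Qed.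
Lemma lprojD : {morph lproj : x y / x + y}.
Proof. by move=> x y; rewrite /lproj !piE. Qed.
Lemma lproj0 : lproj 0 = 0.
Proof. by rewrite -(subrr 0) lprojB subrr. Qed.

Definition lq_scale (a : k) (x : lquot R) : lquot R := lproj (a *: lrepr x).

Lemma lprojZ a x : lproj (a *: x) = lq_scale a (lproj x).
Proof.
apply/lproj_eq; rewrite -scalerBr rpredZ //.
by apply/lproj_eq; rewrite lreprK.
Qed.

Fact lq_scaleA a b v : lq_scale a (lq_scale b v) = lq_scale (a * b) v.
Proof. by rewrite -[v]lreprK -!lprojZ scalerA. Qed.
Fact lq_scale1 : left_id 1 lq_scale.
Proof. by move=> v; rewrite -[v]lreprK -!lprojZ scale1r. Qed.
Fact lq_scaleDr : right_distributive lq_scale +%R.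
Proof.
move=> a u v; rewrite -[u]lreprK -[v]lreprK.
by rewrite -lprojD -!lprojZ -lprojD scalerDr.
Qed.
Fact lq_scaleDl v : {morph lq_scale^~ v : a b / a + b}.
Proof. by move=> a b; rewrite -[v]lreprK -!lprojZ -lprojD scalerDl. Qed.

HB.instance Definition _ := GRing.Zmodule_isLmodule.Build k (lquot R)
  lq_scaleA lq_scale1 lq_scaleDr lq_scaleDl.

Lemma lproj_is_linear : linear lproj.
Proof. by move=> a x y; rewrite lprojD lprojZ. Qed.
HB.instance Definition _ := GRing.isLinear.Build k M (lquot R) _ lproj
  lproj_is_linear.

Lemma lproj_rel x : R x -> lproj x = 0.
Proof.
by move=> Rx; rewrite -lproj0; apply/lproj_eq; rewrite subr0 mem_lin_span.
Qed.

Variables (X : lmodType k) (f : {linear M -> X}).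
Hypothesis fR : forall x, R x -> f x = 0.

Definition llift (x : lquot R) : X := f (lrepr x).

Lemma lliftE x : llift (lproj x) = f x.
Proof.
apply/eqP; rewrite -subr_eq0 -linearB /=; apply/eqP.
have : lrepr (lproj x) - x \in lin_span R by apply/lproj_eq; rewrite lreprK.
move: (_ - x); apply: lin_span_ind => [|y z fy fz|a y Ry].
- by rewrite linear0.
- by rewrite linearD fy fz addr0.
- by rewrite linearZ /= fR // scaler0.
Qed.

Lemma llift_is_linear : linear llift.
Proof.
move=> a x y; rewrite -[x]lreprK -[y]lreprK -linearP !lliftE.
by rewrite linearP.
Qed.
End LQuot.

Section MalgExt.
Variables (k : fieldType) (K : choiceType) (X : lmodType k) (h : K -> X).

Definition malg_ext (g : {malg k[K]}) : X := \sum_(x <- msupp g) g@_x *: h x.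

Lemma malg_extEw (d : {fset K}) g : (msupp g `<=` d)%fset ->
  malg_ext g = \sum_(x <- d) g@_x *: h x.
Proof.
move=> le; rewrite [LHS](big_fset_incl _ le) => //= x xd /mcoeff_outdom ->.
by rewrite scale0r.
Qed.

Lemma malg_ext_is_linear : linear malg_ext.
Proof.
move=> a g1 g2; pose d := (msupp g1 `|` msupp g2)%fset.
have l1 : (msupp g1 `<=` d)%fset by apply: fsubsetUl.
have l2 : (msupp g2 `<=` d)%fset by apply: fsubsetUr.
have l3 : (msupp (a *: g1 + g2) `<=` d)%fset.
  apply: fsubset_trans (msuppD_le _ _) _; apply: fsetSU.
  exact: msuppZ_le.
rewrite !(malg_extEw (d := d)) // scaler_sumr -big_split /=.
by apply: eq_bigr => x _; rewrite mcoeffD mcoeffZ scalerDl scalerA.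
Qed.
HB.instance Definition _ := GRing.isLinear.Build k {malg k[K]} X _ malg_ext
  malg_ext_is_linear.

Lemma malg_extU x : malg_ext << x >> = h x.
Proof. by rewrite (malg_extEw msuppU_le) big_seq_fset1 mcoeffUU scale1r. Qed.

End MalgExt.

Lemma malg_ind (k : fieldType) (K : choiceType) (P : {malg k[K]} -> Prop) :
    P 0 -> (forall x y, P x -> P y -> P (x + y)) ->
    (forall a x, P (a *: << x >>)) -> forall g, P g.
Proof.
move=> P0 PD PZ g; rewrite [g]monalgE; elim/big_ind: _ => // x _.
suff -> : << g@_x *g x >> = g@_x *: << x >> :> {malg k[K]} by [].
by apply/malgP => y; rewrite mcoeffZ !mcoeffU mulrnAr mulr1.
Qed.

Definition bilinear_map (k : fieldType) (U W X : lmodType k) (b : U -> W -> X) :=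
  (forall w, linear (b^~ w)) /\ (forall u, linear (b u)).

(* The uniqueness half of the universal property is stated as: elementary
   tensors span. *)
Record tensor_product (k : fieldType) (U W : lmodType k) := TensorProduct {
  tp_space : lmodType k;
  tp_pure : U -> W -> tp_space;
  tp_pure_bilinear : bilinear_map tp_pure;
  tp_span : forall z, z \in lin_span [set z | exists u w, z = tp_pure u w];
  tp_lift : forall (X : lmodType k) (b : U -> W -> X), bilinear_map b ->
    {linear tp_space -> X};
  tp_liftE : forall X b (hb : bilinear_map b) u w,
    @tp_lift X b hb (tp_pure u w) = b u w
}.

(* U ⊗ W is constructed as the free vector space on U * W modulo bilinearity. *)
Section TensorConstruction.
Variables (k : fieldType) (U W : lmodType k).

Inductive tens_rel : set {malg k[Choice.clone (U * W)%type _]} :=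
| TensRelL a u u' w :
    tens_rel (<< (a *: u + u', w) >> - a *: << (u, w) >> - << (u', w) >>)
| TensRelR a u w w' :
    tens_rel (<< (u, a *: w + w') >> - a *: << (u, w) >> - << (u, w') >>).

Let tens0 : lmodType k := lquot tens_rel.
Let pure0 (u : U) (w : W) : tens0 := lproj tens_rel << (u, w) >>.

Fact pure0_bilinear : bilinear_map pure0.
Proof.
split=> [w a u u'|u a w w']; apply/eqP; rewrite -subr_eq0 opprD addrA /pure0.
  by rewrite -!linearZ -!linearB /=; apply/eqP/lproj_rel/TensRelL.
by rewrite -!linearZ -!linearB /=; apply/eqP/lproj_rel/TensRelR.
Qed.

Fact tens0_span (z : tens0) :
  z \in lin_span [set z | exists u w, z = pure0 u w].
Proof.
rewrite -[z]lreprK; move: (lrepr z); apply: malg_ind => [|x y hx hy|a [u w]].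
- by rewrite linear0 rpred0.
- by rewrite linearD rpredD.
by rewrite linearZ rpredZ //; apply: mem_lin_span; exists u, w.
Qed.

Section Lift.
Variables (X : lmodType k) (b : U -> W -> X).
Hypothesis hb : bilinear_map b.

Fact tens_lift_rel x :
  tens_rel x -> malg_ext (fun p : U * W => b p.1 p.2) x = 0.
Proof.
case: hb => bl br.
by case=> *; rewrite !raddfB /= linearZ /= !malg_extU /= ?bl ?br -addrA -opprD subrr.
Qed.

Let lift0 : tens0 -> X := llift (malg_ext (fun p => b p.1 p.2)).
HB.instance Definition _ := GRing.isLinear.Build k tens0 X _ lift0
  (llift_is_linear tens_lift_rel).

Fact tens_lift0 : exists f : {linear tens0 -> X}, forall u w, f (pure0 u w) = b u w.
Proof.
exists lift0 => u w; rewrite /= /lift0 (lliftE tens_lift_rel); exact: malg_extU.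
Qed.
End Lift.

(* Opaque: only the universal property is used afterwards. *)
Lemma tensor_product_of : tensor_product U W.
Proof.
exact: (@TensorProduct k U W tens0 pure0 pure0_bilinear tens0_span
  (fun X b hb => projT1 (cid (tens_lift0 hb)))
  (fun X b hb => projT2 (cid (tens_lift0 hb)))).
Qed.
End TensorConstruction.

Section Tensor.
Variables (k : fieldType) (U W : lmodType k).

Definition tens : lmodType k := tp_space (tensor_product_of U W).
Definition pure (u : U) (w : W) : tens := tp_pure (tensor_product_of U W) u w.

Lemma pure_bilinear : bilinear_map pure.
Proof. exact: tp_pure_bilinear. Qed.

Lemma pureDl u u' w : pure (u + u') w = pure u w + pure u' w.
Proof. by have := pure_bilinear.1 w 1 u u'; rewrite !scale1r. Qed.
Lemma pureDr u w w' : pure u (w + w') = pure u w + pure u w'.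
Proof. by have := pure_bilinear.2 u 1 w w'; rewrite !scale1r. Qed.
Lemma pure0l w : pure 0 w = 0.
Proof. by apply: (addIr (pure 0 w)); rewrite -pureDl !add0r. Qed.
Lemma pure0r u : pure u 0 = 0.
Proof. by apply: (addIr (pure u 0)); rewrite -pureDr !add0r. Qed.
Lemma pureZl a u w : pure (a *: u) w = a *: pure u w.
Proof. by have := pure_bilinear.1 w a u 0; rewrite pure0l !addr0. Qed.
Lemma pureZr a u w : pure u (a *: w) = a *: pure u w.
Proof. by have := pure_bilinear.2 u a w 0; rewrite pure0r !addr0. Qed.

Lemma tens_ind (P : tens -> Prop) :
    P 0 -> (forall x y, P x -> P y -> P (x + y)) ->
    (forall a u w, P (a *: pure u w)) -> forall x, P x.
Proof.
move=> P0 PD PZ x; have := tp_span x; move: x.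
by apply: lin_span_ind => // a _ [u [w ->]]; apply: PZ.
Qed.

Section Lift.
Variables (X : lmodType k) (b : U -> W -> X) (hb : bilinear_map b).
Definition tens_lift : {linear tens -> X} := tp_lift (tensor_product_of U W) hb.
Lemma tens_liftE u w : tens_lift (pure u w) = b u w.
Proof. exact: tp_liftE. Qed.
End Lift.
End Tensor.

Notation "u ⊗ w" := (pure u w) (at level 40, left associativity) : ring_scope.

Section TensMap.
Variables (k : fieldType) (U W U' W' : lmodType k).
Variables (f : {linear U -> U'}) (g : {linear W -> W'}).

Fact tens_map_bilinear : bilinear_map (fun u w => f u ⊗ g w).
Proof.
split=> [w a u u'|u a w w'].
  by rewrite linearP pureDl pureZl.
by rewrite linearP pureDr pureZr.
Qed.

Definition tens_map : {linear tens U W -> tens U' W'} :=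
  tens_lift tens_map_bilinear.

Lemma tens_mapE u w : tens_map (u ⊗ w) = f u ⊗ g w.
Proof. exact: tens_liftE. Qed.
End TensMap.

(* The algebras of the library are nonzero rings. The zero algebra is allowed
   here, so unital associative algebras are structured over [lmodType]. *)
HB.mixin Record Lmodule_isUnitalAlgebra (k : fieldType) A
    of GRing.Lmodule k A := {
  uone : A;
  umul : A -> A -> A;
  umulA : associative umul;
  umul1x : left_id uone umul;
  umulx1 : right_id uone umul;
  umul_linearl : forall y, linear (umul^~ y);
  umul_linearr : forall x, linear (umul x)
}.

#[short(type="ualgType")]
HB.structure Definition UnitalAlgebra (k : fieldType) :=
  {A of GRing.Lmodule k A & Lmodule_isUnitalAlgebra k A}.

Arguments uone {k s}.
Notation "x ** y" := (umul x y) (at level 40, left associativity) : ring_scope.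
Notation "\uprod_ ( v <- s ) F" := (\big[umul/uone]_(v <- s) F)
  (at level 41, F at level 41, v, s at level 50) : ring_scope.

HB.instance Definition _ (k : fieldType) (A : ualgType k) :=
  Monoid.isLaw.Build A uone umul umulA umul1x umulx1.

Section UAlgTheory.
Variables (k : fieldType) (A : ualgType k).
Implicit Types x y z : A.

Lemma umulDl x y z : (x + y) ** z = x ** z + y ** z.
Proof. by have := umul_linearl z 1 x y; rewrite !scale1r. Qed.
Lemma umulDr x y z : x ** (y + z) = x ** y + x ** z.
Proof. by have := umul_linearr x 1 y z; rewrite !scale1r. Qed.
Lemma umul0x x : 0 ** x = 0.
Proof. by apply: (addIr (0 ** x)); rewrite -umulDl !add0r. Qed.
Lemma umulx0 x : x ** 0 = 0.
Proof. by apply: (addIr (x ** 0)); rewrite -umulDr !add0r. Qed.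
Lemma umulZl a x y : (a *: x) ** y = a *: (x ** y).
Proof. by have := umul_linearl y a x 0; rewrite umul0x !addr0. Qed.
Lemma umulZr a x y : x ** (a *: y) = a *: (x ** y).
Proof. by have := umul_linearr x a y 0; rewrite umulx0 !addr0. Qed.

Fact umul_bilinear : bilinear_map (@umul k A).
Proof. by split; [apply: umul_linearl|apply: umul_linearr]. Qed.

Definition umult : {linear tens A A -> A} := tens_lift umul_bilinear.

Lemma umultE x y : umult (x ⊗ y) = x ** y.
Proof. exact: tens_liftE. Qed.
End UAlgTheory.
Arguments umult {k A}.

Definition subalgebra (k : fieldType) (A : ualgType k) (S : set A) :=
  [/\ S uone, forall a x y, S x -> S y -> S (a *: x + y)
    & forall x y, S x -> S y -> S (x ** y)].

Definition alg_morphism (k : fieldType) (A B : ualgType k) (f : A -> B) :=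
  f uone = uone /\ forall x y, f (x ** y) = f x ** f y.

(* The uniqueness half of the universal property is stated as: V generates. *)
Record tensor_algebra (k : fieldType) (V : lmodType k) := TensorAlgebra {
  ta_alg : ualgType k;
  ta_vec : {linear V -> ta_alg};
  ta_generated : forall S : set ta_alg, subalgebra S ->
    (forall v, S (ta_vec v)) -> forall x, S x;
  ta_lift : forall A : ualgType k, {linear V -> A} -> {linear ta_alg -> A};
  ta_lift_morphism : forall (A : ualgType k) (f : {linear V -> A}), alg_morphism (ta_lift f);
  ta_liftE : forall (A : ualgType k) (f : {linear V -> A}) v, ta_lift f (ta_vec v) = f v
}.

Definition word (V : choiceType) := seq V.
HB.instance Definition _ (V : choiceType) := Choice.on (word V).
Fact word_unit (V : choiceType) (s t : word V) :
  s ++ t = [::] -> s = [::] /\ t = [::].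
Proof. by case: s t => [|? ?] []. Qed.
HB.instance Definition _ (V : choiceType) :=
  Choice_isMonomialDef.Build (word V) (@catA V) (@cat0s V) (@cats0 V)
    (@word_unit V).

(* V^⊗ is constructed as the free algebra on the set V modulo linearity. *)
Section TensorAlgebraConstruction.
Variables (k : fieldType) (V : lmodType k).

Local Notation FA := {malg k[Choice.clone (word V) _]}.

Definition letter (v : V) : FA := << ([:: v] : word V) >>.

(* The span of these relations is the two-sided ideal of the free algebra on
   the set [V] that makes [letter] linear. *)
Inductive talg_rel : set FA :=
| TalgRel (x y : FA) a v w :
    talg_rel (x * (letter (a *: v + w) - a *: letter v - letter w) * y).

Definition talg0 := lquot talg_rel.
HB.instance Definition _ := GRing.Lmodule.on talg0.

Definition talg_one : talg0 := lproj talg_rel 1.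
Definition talg_mul (x y : talg0) : talg0 := lproj talg_rel (lrepr x * lrepr y).

Fact malg_scalerAr a (x y : FA) : a *: (x * y) = x * (a *: y).
Proof.
rewrite -[a *: y]mul_malgC -mul_malgC !mulrA; congr (_ * y).
move: x; apply: malg_ind => [|x z hx hz|b x]; first by rewrite mulr0 mul0r.
  by rewrite mulrDl mulrDr hx hz.
rewrite mul_malgC -!scalerAl !scalerA [a * b]mulrC -scalerA; congr (_ *: _).
rewrite -mul_malgC !malgM_def !fgmulUU mulr1 mul1r.
by rewrite mul1m mulm1.
Qed.

Fact talg_ideal (x r y : FA) :
  r \in lin_span talg_rel -> x * r * y \in lin_span talg_rel.
Proof.
move: r; apply: lin_span_ind => [|r1 r2 h1 h2|a _ [x' y' b v w]].
- by rewrite mulr0 mul0r rpred0.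
- by rewrite mulrDr mulrDl; apply: rpredD; [apply: h1|apply: h2].
rewrite -malg_scalerAr -scalerAl rpredZ //; apply: mem_lin_span.
set d := letter _ - _ - _.
have -> : x * (x' * d * y') * y = (x * x') * d * (y' * y) by rewrite !mulrA.
exact: TalgRel.
Qed.

Lemma talg_projM x y :
  lproj talg_rel (x * y) = talg_mul (lproj talg_rel x) (lproj talg_rel y).
Proof.
apply/lproj_eq; set x' := lrepr _; set y' := lrepr _.
have hx : x - x' \in lin_span talg_rel by apply/lproj_eq; rewrite lreprK.
have hy : y - y' \in lin_span talg_rel by apply/lproj_eq; rewrite lreprK.
have -> : x * y - x' * y' = 1 * (x - x') * y + x' * (y - y') * 1.
  by rewrite mul1r mulr1 mulrBl mulrBr addrA subrK.
by rewrite rpredD // talg_ideal.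
Qed.

Fact talg_mulA : associative talg_mul.
Proof.
move=> x y z; rewrite -[x]lreprK -[y]lreprK -[z]lreprK.
by rewrite -!talg_projM mulrA.
Qed.
Fact talg_mul1 : left_id talg_one talg_mul.
Proof. by move=> x; rewrite -[x]lreprK -talg_projM mul1r. Qed.
Fact talg_mulr1 : right_id talg_one talg_mul.
Proof. by move=> x; rewrite -[x]lreprK -talg_projM mulr1. Qed.
Fact talg_linearl y : linear (talg_mul^~ y).
Proof.
move=> a x x'; rewrite -[x]lreprK -[x']lreprK -[y]lreprK.
by rewrite -linearP -!talg_projM -linearP mulrDl scalerAl.
Qed.
Fact talg_linearr x : linear (talg_mul x).
Proof.
move=> a y y'; rewrite -[x]lreprK -[y]lreprK -[y']lreprK.
by rewrite -linearP -!talg_projM -linearP mulrDr malg_scalerAr.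
Qed.
HB.instance Definition _ := Lmodule_isUnitalAlgebra.Build k talg0
  talg_mulA talg_mul1 talg_mulr1 talg_linearl talg_linearr.

Definition tvec0 (v : V) : talg0 := lproj talg_rel (letter v).

Fact tvec0_is_linear : linear tvec0.
Proof.
move=> a v w; apply/eqP; rewrite -subr_eq0 opprD addrA /tvec0.
rewrite -!linearZ -!linearB /=; apply/eqP/lproj_rel.
by rewrite -[X in talg_rel X]mul1r -[X in talg_rel X]mulr1; apply: TalgRel.
Qed.
HB.instance Definition _ := GRing.isLinear.Build k V talg0 _ tvec0 tvec0_is_linear.

Fact talg0_generated (S : set talg0) :
  subalgebra S -> (forall v, S (tvec0 v)) -> forall x, S x.
Proof.
move=> [S1 SP SM] SV x.
have S0 : S 0 by have := SP (-1) _ _ S1 S1; rewrite scaleN1r addNr.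
rewrite -[x]lreprK; move: (lrepr x); apply: malg_ind => [|y z hy hz|a s].
- by rewrite linear0.
- by have := SP 1 _ _ hy hz; rewrite scale1r -linearD.
suff Ss : S (lproj talg_rel << s >>).
  by have := SP a _ _ Ss S0; rewrite addr0 -linearZ.
elim: s => [|v s IHs]; first exact: S1.
suff -> : lproj talg_rel << (v :: s : word V) >> =
          (tvec0 v : talg0) ** lproj talg_rel << s >> by apply: SM.
rewrite -[RHS]/(talg_mul _ _) -talg_projM; congr (lproj _ _).
by rewrite malgM_def fgmulUU mulr1.
Qed.

Section Lift.
Variables (A : ualgType k) (f : {linear V -> A}).

Local Notation ev := (malg_ext (fun s : word V => \big[umul/uone]_(v <- s) f v)).

Fact talg_evM (x y : FA) : ev (x * y) = ev x ** ev y.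
Proof.
move: x; apply: malg_ind => [|x x' hx hx'|a s]; first by rewrite mul0r !linear0 umul0x.
  by rewrite mulrDl !linearD /= umulDl hx hx'.
rewrite -scalerAl !linearZ /= umulZl; congr (_ *: _).
move: y; apply: malg_ind => [|y y' hy hy'|b t]; first by rewrite mulr0 !linear0 umulx0.
  by rewrite mulrDr !linearD /= umulDr hy hy'.
rewrite -malg_scalerAr !linearZ /= umulZr; congr (_ *: _).
by rewrite malgM_def fgmulUU mulr1 !malg_extU big_cat.
Qed.

Fact talg_ev_rel (x : FA) : talg_rel x -> ev x = 0.
Proof.
case=> {}x y a v w; rewrite !talg_evM !raddfB /= linearZ /= !malg_extU !big_seq1.
by rewrite linearP -addrA -opprD subrr umulx0 umul0x.
Qed.

Definition talg0_lift : talg0 -> A := llift ev.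
HB.instance Definition _ := GRing.isLinear.Build k talg0 A _ talg0_lift
  (llift_is_linear talg_ev_rel).

Fact talg0_lift_morphism : alg_morphism talg0_lift.
Proof.
split=> [|x y].
  rewrite -[uone in LHS]/talg_one /talg0_lift /talg_one (lliftE talg_ev_rel) /=.
  by rewrite malg_extU big_nil.
rewrite -[x]lreprK -[y]lreprK -[_ ** _]/(talg_mul _ _) -talg_projM /talg0_lift.
by rewrite !(lliftE talg_ev_rel) /= talg_evM.
Qed.

Fact talg0_liftE v : talg0_lift (tvec0 v) = f v.
Proof. by rewrite /talg0_lift (lliftE talg_ev_rel) /= malg_extU big_seq1. Qed.
End Lift.

(* Opaque: only the universal property is used afterwards. *)
Lemma tensor_algebra_of : tensor_algebra V.
Proof.
exact: (@TensorAlgebra k V talg0 tvec0 talg0_generated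
  (fun A f => talg0_lift f) (fun A f => talg0_lift_morphism f)
  (fun A f => talg0_liftE f)).
Qed.
End TensorAlgebraConstruction.

Section TensorAlgebra.
Variables (k : fieldType) (V : lmodType k).

Definition talg : ualgType k := ta_alg (tensor_algebra_of V).
Definition tvec : {linear V -> talg} := ta_vec (tensor_algebra_of V).
Definition talg_lift (A : ualgType k) (f : {linear V -> A}) : {linear talg -> A} :=
  ta_lift (tensor_algebra_of V) f.

Lemma talg_lift_morphism (A : ualgType k) (f : {linear V -> A}) :
  alg_morphism (talg_lift f).
Proof. exact: ta_lift_morphism. Qed.
Lemma talg_liftE (A : ualgType k) (f : {linear V -> A}) v :
  talg_lift f (tvec v) = f v.
Proof. exact: ta_liftE. Qed.

(* V^{⊗r} as a subspace of V^⊗. *)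
Definition tpow (r : nat) : {pred talg} :=
  lin_span [set \uprod_(v <- s) tvec v | s in [set s : seq V | size s = r]].

(* V^{⊗r} ⊗ V^{⊗s} as a subspace of V^⊗ ⊗ V^⊗. *)
Definition bitpow (r s : nat) : {pred tens talg talg} :=
  lin_span [set z | exists x y, [/\ x \in tpow r, y \in tpow s & z = x ⊗ y]].

Lemma tpow_word (s : seq V) : \uprod_(v <- s) tvec v \in tpow (size s).
Proof. by apply: mem_lin_span; exists s. Qed.

Lemma talg_span x :
  x \in lin_span [set \uprod_(v <- s) tvec v | s in [set: seq V]].
Proof.
set R := [set _ | _ in _].
have wR s : \uprod_(v <- s) tvec v \in lin_span R.
  by apply: mem_lin_span; exists s.
apply: (@ta_generated _ _ (tensor_algebra_of V) (fun x => x \in lin_span R)).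
- split=> [|a y z hy hz|y z].
  + by have := wR [::]; rewrite big_nil.
  + by rewrite rpredD // rpredZ.
  move: y; apply: lin_span_ind => [|y y' hy hy' hz|a _ [s _ <-]].
  + by rewrite umul0x rpred0.
  + by rewrite umulDl rpredD ?hy ?hy'.
  move: z; apply: lin_span_ind => [|z z' hz hz'|b _ [t _ <-]].
  + by rewrite umulx0 rpred0.
  + by rewrite umulDr rpredD.
  by rewrite umulZl umulZr !rpredZ // -big_cat.
by move=> v; have := wR [:: v]; rewrite big_seq1.
Qed.

Lemma talg_ind (P : talg -> Prop) :
    P 0 -> (forall x y, P x -> P y -> P (x + y)) ->
    (forall r x, x \in tpow r -> P x) -> forall x, P x.
Proof.
move=> P0 PD PW x; have := talg_span x; move: x.
apply: lin_span_ind => // a _ [s _ <-]; apply: (PW (size s)).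
by rewrite rpredZ // tpow_word.
Qed.
End TensorAlgebra.
Arguments tvec {k V}.

Section Cochains.
Variables (k : fieldType) (V : lmodType k).
Local Notation T := (talg V).
Implicit Type psi : {linear tens T T -> tens T T}.

Definition cochain2 psi :=
  bijective psi /\ forall r s, psi @` [set` bitpow r s] = [set` bitpow r s].

(* Through the multiplication of V^⊗, the value of psi_{r,s} ⊗ id_t at
   x ⊗ y ⊗ z is [umult (psi (x ⊗ y)) ⊗ z] in V^{⊗(r+s)} ⊗ V^{⊗t}, and similarly
   for id_r ⊗ psi_{s,t}; the outer [umult] compares the two composites in
   V^{⊗(r+s+t)}. *)
Definition cocycle2 psi := forall r s t x y z,
  x \in tpow r -> y \in tpow s -> z \in tpow t ->
  umult (psi (umult (psi (x ⊗ y)) ⊗ z)) =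
  umult (psi (x ⊗ umult (psi (y ⊗ z)))).

Definition counital psi :=
  forall a : T, psi (uone ⊗ a) = uone ⊗ a /\ psi (a ⊗ uone) = a ⊗ uone.

Definition Z2 psi := [/\ cochain2 psi, cocycle2 psi & counital psi].

End Cochains.

Record quantum_space (k : fieldType) := QuantumSpace {
  qs_alg :> ualgType k;
  qs_gen : submodClosed qs_alg;
  qs_gen_finite : exists s : seq qs_alg, qs_gen =i lin_span [set` s];
  qs_generated : forall S : set qs_alg, subalgebra S ->
    (forall x, x \in qs_gen -> S x) -> forall x, S x
}.

Definition gens (k : fieldType) (A : quantum_space k) := {x : A | x \in qs_gen A}.
HB.instance Definition _ k A := Choice.on (@gens k A).
HB.instance Definition _ k A := SubType.on (@gens k A).
HB.instance Definition _ k A := [SubChoice_isSubLmodule of @gens k A by <:].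

Section Twisting.
Variables (k : fieldType) (A : quantum_space k).
Local Notation T := (talg (gens A)).

Definition Pi : {linear T -> A} := talg_lift (\val : {linear gens A -> A}).

Lemma Pi1 : Pi uone = uone. Proof. exact: (talg_lift_morphism _).1. Qed.
Lemma PiM x y : Pi (x ** y) = Pi x ** Pi y.
Proof. exact: (talg_lift_morphism _).2. Qed.
Lemma PiE v : Pi (tvec v) = \val v. Proof. exact: talg_liftE. Qed.

Definition ker_Pi2 : set (tens T T) := [set w | tens_map Pi Pi w = 0].

Variable psi : {linear tens T T -> tens T T}.

Definition admissible := psi @` ker_Pi2 = ker_Pi2.

(* The map with Psi ∘ Pi^{⊗2} = Pi^{⊗2} ∘ psi: apply psi to any preimage. *)
Definition Psi (w : tens A A) : tens A A :=
  tens_map Pi Pi (psi (xget 0 [set u | tens_map Pi Pi u = w])).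

Definition twist_mul (x y : A) : A := umult (Psi (x ⊗ y)).

Lemma Pi_surj x : exists u, Pi u = x.
Proof.
move: x; apply: (@qs_generated k A (fun x => exists u, Pi u = x)); first split.
- by exists uone; apply: Pi1.
- by move=> a _ _ [u <-] [v <-]; exists (a *: u + v); rewrite linearP.
- by move=> _ _ [u <-] [v <-]; exists (u ** v); apply: PiM.
by move=> x xA; exists (tvec (exist _ x xA : gens A)); rewrite PiE.
Qed.

Hypothesis psiA : admissible.

Lemma PsiE w : Psi (tens_map Pi Pi w) = tens_map Pi Pi (psi w).
Proof.
rewrite /Psi; case: xgetP => [u _ uw|/(_ w) /(_ erefl) //].
have : ker_Pi2 (psi (u - w)).
  rewrite -psiA; exists (u - w) => //.
  by rewrite /ker_Pi2 /= linearB uw subrr.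
by rewrite /ker_Pi2 /= !linearB => /eqP; rewrite subr_eq0 => /eqP.
Qed.

Lemma umult_Pi2 w : umult (tens_map Pi Pi w) = Pi (umult w).
Proof.
move: w; apply: tens_ind => [|x y hx hy|a x y].
- by rewrite !linear0.
- by rewrite !linearD hx hy.
- by rewrite !linearZ /= tens_mapE !umultE PiM.
Qed.

Lemma twist_mulE u v : twist_mul (Pi u) (Pi v) = Pi (umult (psi (u ⊗ v))).
Proof. by rewrite /twist_mul -tens_mapE PsiE umult_Pi2. Qed.

Hypothesis psiZ : Z2 psi.

Fact twist_linearl y : linear (twist_mul^~ y).
Proof.
move=> a x x'; have [u <-] := Pi_surj x; have [u' <-] := Pi_surj x'.
have [v <-] := Pi_surj y.
by rewrite -linearP !twist_mulE pureDl pureZl !linearP.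
Qed.

Fact twist_linearr x : linear (twist_mul x).
Proof.
move=> a y y'; have [v <-] := Pi_surj y; have [v' <-] := Pi_surj y'.
have [u <-] := Pi_surj x.
by rewrite -linearP !twist_mulE pureDr pureZr !linearP.
Qed.

Fact twist_1x : left_id uone twist_mul.
Proof.
move=> x; have [u <-] := Pi_surj x; rewrite -Pi1.
case: psiZ => _ _ /(_ u) [h _].
by rewrite twist_mulE h umultE umul1x.
Qed.

Fact twist_x1 : right_id uone twist_mul.
Proof.
move=> x; have [u <-] := Pi_surj x; rewrite -Pi1.
case: psiZ => _ _ /(_ u) [_ h].
by rewrite twist_mulE h umultE umulx1.
Qed.

Lemma cocycle2_all (x y z : T) :
  umult (psi (umult (psi (x ⊗ y)) ⊗ z)) = umult (psi (x ⊗ umult (psi (y ⊗ z)))).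
Proof.
move: x; apply: talg_ind => [|x x' hx hx'|r x xr].
- by rewrite !(pure0l, linear0).
- by rewrite !(pureDl, linearD) hx hx'.
move: y; apply: talg_ind => [|y y' hy hy'|s y ys].
- by rewrite !(pure0l, pure0r, linear0).
- by rewrite !(pureDl, pureDr, linearD) hy hy'.
move: z; apply: talg_ind => [|z z' hz hz'|t z zt].
- by rewrite !(pure0r, linear0).
- by rewrite !(pureDr, linearD) hz hz'.
by case: psiZ => _ h _; apply: h xr ys zt.
Qed.

Fact twist_A : associative twist_mul.
Proof.
move=> x y z; have [u <-] := Pi_surj x; have [v <-] := Pi_surj y.
by have [w <-] := Pi_surj z; rewrite !twist_mulE cocycle2_all.
Qed.

(* The vector space of [A], to be equipped with the product [twist_mul]. *)
Definition twisted of admissible & Z2 psi : Type := A.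
End Twisting.
Arguments Pi {k A}.

HB.instance Definition _ k A psi hA hZ :=
  GRing.Lmodule.on (@twisted k A psi hA hZ).
HB.instance Definition _ k A psi hA hZ :=
  Lmodule_isUnitalAlgebra.Build k (@twisted k A psi hA hZ)
    (twist_A hA hZ) (twist_1x hA hZ) (twist_x1 hA hZ)
    (twist_linearl hA) (twist_linearr hA).

Section TwistedSpace.
Variables (k : fieldType) (A : quantum_space k).
Local Notation T := (talg (gens A)).
Variables (psi : {linear tens T T -> tens T T}).
Hypotheses (psiA : admissible psi) (psiZ : Z2 psi).

Lemma tpowM_span r u : u \in tpow r.+1 ->
  u \in lin_span [set w : T | exists x y, [/\ x \in tpow r, y \in tpow 1 & w = x ** y]].
Proof.
move: u; apply: lin_span_ind => [|u v hu hv|a _ [s sr <-]].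
- exact: rpred0.
- exact: rpredD.
rewrite rpredZ //; apply: mem_lin_span.
case/lastP: s sr => // s v; rewrite /= size_rcons => -[sr].
exists (\uprod_(v <- s) tvec v), (tvec v); split.
- by apply: mem_lin_span; exists s.
- by apply: mem_lin_span; exists [:: v] => //=; rewrite big_seq1.
by rewrite big_rcons /=.
Qed.

Fact twisted_generated (S : set (twisted psiA psiZ)) : subalgebra S ->
  (forall x, x \in qs_gen A -> S x) -> forall x, S x.
Proof.
move=> [S1 SP SM] SA x.
have S0 : S 0 by have := SP (-1) _ _ S1 S1; rewrite scaleN1r addNr.
have SD a b : S a -> S b -> S (a + b).
  by move=> Sa Sb; rewrite -[a]scale1r; apply: SP.
have SZ c a : S a -> S (c *: a).
  by move=> Sa; rewrite -[_ *: _]addr0; apply: SP.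
have [u <-] := Pi_surj x; move: u; apply: talg_ind => [|u v hu hv|r].
- by rewrite linear0.
- by rewrite linearD; apply/SD.
elim: r => [|r IHr] u.
  move: u; apply: lin_span_ind => [|u v hu hv|a _ [s /size0nil -> <-]].
  - by rewrite linear0.
  - by rewrite linearD; apply/SD.
  by rewrite linearZ big_nil /=; apply/SZ; rewrite Pi1.
have S_V v : v \in tpow 1 -> S (Pi v).
  move: v; apply: lin_span_ind => [|v w hv hw|a _ [[|v [|//]] // _ <-]].
  - by rewrite linear0.
  - by rewrite linearD; apply/SD.
  rewrite linearZ big_seq1; apply/SZ; rewrite PiE.
  by apply: SA; apply: valP.
move: u => u /tpowM_span; move: u.
apply: lin_span_ind => [|u v hu hv|a _ [x0 [y [xr y1 ->]]]].
- by rewrite linear0.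
- by rewrite linearD; apply/SD.
rewrite linearZ; apply/SZ; rewrite -umultE.
case: (psiZ) => -[_ /(_ r 1%N) im] _ _.
have : [set` bitpow r 1] (x0 ⊗ y) by apply: mem_lin_span; exists x0, y.
rewrite -im => -[w /= wr <-]; move: w wr.
apply: lin_span_ind => [|w w' hw hw'|b _ [x1 [y' [x1r y'1 ->]]]].
- by rewrite !linear0.
- by rewrite !linearD; apply/SD.
rewrite !linearZ; apply/SZ; rewrite -(twist_mulE psiA).
by apply: SM; [apply: IHr|apply: S_V].
Qed.

Definition twisting : quantum_space k :=
  @QuantumSpace k (twisted psiA psiZ) (qs_gen A) (@qs_gen_finite k A)
    twisted_generated.

End TwistedSpace.

Section TwistRelation.
Variable k : fieldType.

Definition qs_morphism (A B : quantum_space k) (f : {linear A -> B}) :=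
  alg_morphism f /\ (forall x, x \in qs_gen A -> f x \in qs_gen B).

Definition qs_iso (A B : quantum_space k) :=
  exists (f : {linear A -> B}) (g : {linear B -> A}),
    [/\ qs_morphism f, qs_morphism g, cancel f g & cancel g f].

Definition twist_related (A B : quantum_space k) :=
  exists psi (psiA : admissible psi) (psiZ : Z2 psi), qs_iso (@twisting k A psi psiA psiZ) B.

End TwistRelation.

(* Main.v *)
Require Import Defs.
From Corelib Require Import RelationClasses.
From HB Require Import structures.
From mathcomp Require Import all_boot all_algebra reals complex.
From mathcomp Require Import boolp classical_sets.

(** A counital 2-cocycle [psi] on [V] twists not only the algebra [A] but also
    the tensor algebra of [V] itself, into an algebra with product [m psi].
    By freeness there is a unique algebra morphism [theta] from the tensor
    algebra to its twist that fixes [V].  The whole proof rests on [theta] being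
    bijective ([theta_bij]): in other words, every counital 2-cocycle is the
    coboundary of a graded automorphism of the tensor algebra.  Surjectivity is
    proved by induction on the degree, because [psi] is onto on each
    bihomogeneous component, and injectivity follows because [theta] then maps
    enough finite-dimensional subspaces onto themselves.

    Consequently, [A_psi] is isomorphic to [B] exactly when there are a linear
    isomorphism [A -> B], covered by a graded linear isomorphism [tau] between
    the tensor algebras, and a bigraded counital admissible [psi] with
    [tau m psi = m (tau ⊗ tau)] (the record [gauge]).  The last equation makes
    [psi] a cocycle: it says that [m psi] is the product of the second tensor
    algebra carried along [tau], and the cocycle identity is the associativity of
    that product ([gauge_twist_related]).  Conversely, an isomorphism
    [f : A_psi -> B] yields [tau] as [theta^-1] followed by the morphism of
    tensor algebras induced by [f] on generators ([twist_related_gauge]).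

    In this form the relation is visibly an equivalence.  The identity gives
    reflexivity.  Inverting [tau] and replacing [psi] by
    [(tau ⊗ tau) psi^-1 (tau ⊗ tau)^-1] gives symmetry.  For transitivity, one
    composes [tau1], [tau2] and takes
    [psi1 (tau1 ⊗ tau1)^-1 psi2 (tau1 ⊗ tau1)].  All this holds over an arbitrary
    field. *)

Set Implicit Arguments.
Unset Strict Implicit.
Unset Printing Implicit Defensive.

Import GRing.Theory.
Local Open Scope ring_scope.
Local Open Scope classical_set_scope.

(** * Linear spans and surjective endomorphisms *)

Section LinearMaps.
Variable k : fieldType.

Lemma linear_inverse (U V : lmodType k) (f : {linear U -> V}) :
  bijective f -> exists2 g : {linear V -> U}, cancel f g & cancel g f.
Proof.
case=> g fK gK.
pose gl := HB.pack_for {linear V -> U} g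
  (GRing.isLinear.Build k V U _ g (can2_linear fK gK)).
by exists gl.
Qed.

Lemma lin_span_image (U V : lmodType k) (f : {linear U -> V}) (P : set U)
    (Q : set V) :
  (forall x, P x -> f x \in lin_span Q) ->
  forall x, x \in lin_span P -> f x \in lin_span Q.
Proof.
move=> fPQ; apply: lin_span_ind => [|y z hy hz|a y Py].
- by rewrite linear0 rpred0.
- by rewrite linearD rpredD.
- by rewrite linearZ rpredZ // fPQ.
Qed.

Lemma lin_span_preimage (U V : lmodType k) (f : {linear U -> V}) (P : set U)
    (Q : set V) :
  (forall y, Q y -> exists2 x, x \in lin_span P & f x = y) ->
  forall y, y \in lin_span Q -> exists2 x, x \in lin_span P & f x = y.
Proof.
move=> fPQ; apply: lin_span_ind => [|_ _ [x hx <-] [x' hx' <-]|a y' Qy].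
- by exists 0; rewrite ?rpred0 ?linear0.
- by exists (x + x'); rewrite ?rpredD ?linearD.
by have [x hx <-] := fPQ _ Qy; exists (a *: x); rewrite ?rpredZ ?linearZ.
Qed.

Lemma lin_spanS (U : lmodType k) (P Q : set U) :
  (forall x, P x -> x \in lin_span Q) ->
  forall x, x \in lin_span P -> x \in lin_span Q.
Proof. exact: (lin_span_image (f := idfun)). Qed.

End LinearMaps.

Section SurjectiveEndomorphism.
Variables (k : fieldType) (M : lmodType k) (f : {linear M -> M}).

Definition lincomb n (e : 'I_n -> M) (c : 'rV[k]_n) : M := \sum_i c 0 i *: e i.

Lemma lincomb_is_linear n (e : 'I_n -> M) : linear (lincomb e).
Proof.
move=> a c d; rewrite /lincomb scaler_sumr -big_split /=.
by apply: eq_bigr => i _; rewrite !mxE scalerDl scalerA.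
Qed.
HB.instance Definition _ n e := GRing.isLinear.Build k 'rV[k]_n M _ (@lincomb n e)
  (@lincomb_is_linear n e).

Lemma lincomb_delta n (e : 'I_n -> M) i : lincomb e (delta_mx 0 i) = e i.
Proof.
rewrite /lincomb (bigD1 i) //= big1 => [|j ji].
  by rewrite mxE !eqxx scale1r addr0.
by rewrite mxE (negPf ji) andbF scale0r.
Qed.

Lemma lincomb_mulmx n (e : 'I_n -> M) (g : {linear M -> M}) (A : 'M[k]_n) :
  (forall i, g (e i) = lincomb e (row i A)) ->
  forall c, g (lincomb e c) = lincomb e (c *m A).
Proof.
move=> gA c; rewrite {1}/lincomb linear_sum mulmx_sum_row linear_sum /=.
by apply: eq_bigr => i _; rewrite !linearZ /= gA.
Qed.

(** A surjective endomorphism of a finite-dimensional space is injective, for a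
    space given only by a spanning family.  If the family is free, surjectivity
    gives a one-sided inverse of the matrix of [f], which is two-sided; otherwise
    one vector of the family can be dropped without changing the span. *)
Lemma lincomb_surj_inj n (e : 'I_n -> M) :
  (forall c, exists d, f (lincomb e c) = lincomb e d) ->
  (forall c, exists d, lincomb e c = f (lincomb e d)) ->
  forall c, f (lincomb e c) = 0 -> lincomb e c = 0.
Proof.
elim: n e => [|n IHn] e fin fsur.
  by move=> c _; rewrite /lincomb big_ord0.
have [free|] := pselect (forall c, lincomb e c = 0 -> c = 0).
  have [A hA] := choice (fun i => fin (delta_mx 0 i)).
  have [B hB] := choice (fun i => fsur (delta_mx 0 i)).
  pose MA := \matrix_i A i; pose MB := \matrix_i B i.
  have fE : forall c, f (lincomb e c) = lincomb e (c *m MA).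
    by apply: lincomb_mulmx => i; rewrite rowK -hA lincomb_delta.
  (* B expresses preimages of the vectors e i, A their images *)
  have BA : MB *m MA = 1%:M.
    apply/row_matrixP => i; apply/eqP; rewrite -subr_eq0; apply/eqP/free.
    by rewrite linearB /= row_mul -fE rowK -hB row1 subrr.
  move=> c; rewrite fE => /free cA.
  by rewrite -[c]mulmx1 -(mulmx1C BA) mulmxA cA mul0mx linear0.
case/existsNP=> c0 /not_implyP[e0 /eqP/rV0Pn[i c0i]].
(* the nontrivial relation c0 expresses e i through the other vectors *)
pose e' j := e (lift i j).
have to c : exists d, lincomb e c = lincomb e' d.
  exists (\row_j (c 0 (lift i j) - c 0 i / c0 0 i * c0 0 (lift i j))).
  have -> : lincomb e c = lincomb e (c - (c 0 i / c0 0 i) *: c0).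
    by rewrite linearB linearZ /= e0 scaler0 subr0.
  rewrite /lincomb (bigD1_ord i) //= !mxE divfK // subrr scale0r add0r.
  by apply: eq_bigr => j _; rewrite !mxE.
have from d : exists c, lincomb e' d = lincomb e c.
  exists (\row_j (if unlift i j is Some l then d 0 l else 0)).
  rewrite /lincomb [RHS](bigD1_ord i) //= mxE unlift_none scale0r add0r.
  by apply: eq_bigr => j _; rewrite mxE liftK.
move=> c fc; have [d cd] := to c.
rewrite cd; apply: IHn => [c'|c'|]; last by rewrite -cd.
- have [d' ->] := from c'; have [d'' ->] := fin d'.
  exact: to.
- have [d' ->] := from c'; have [d'' ->] := fsur d'.
  by have [d3 ->] := to d''; exists d3.
Qed.

Lemma lin_span_lincomb (s : seq M) x :
  x \in lin_span [set` s] <-> exists c, x = lincomb (tnth (in_tuple s)) c.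
Proof.
split=> [|[c ->]].
  move: x; apply: lin_span_ind => [|_ _ [c ->] [d ->]|a x xs].
  - by exists 0; rewrite linear0.
  - by exists (c + d); rewrite linearD.
  have /tnthP[i ->] : x \in in_tuple s by [].
  by exists (a *: delta_mx 0 i); rewrite linearZ /= lincomb_delta.
by apply: rpred_sum => i _; rewrite rpredZ // mem_lin_span //= mem_tnth.
Qed.

(** The condition is put on the generators only, and is local: an endomorphism of
    an infinite-dimensional space is injective as soon as each vector lies in the
    span of such a list, which is how it is used for the tensor algebra. *)
Definition balanced (s : seq M) := forall x, x \in s ->
  f x \in lin_span [set` s] /\ exists2 y, y \in lin_span [set` s] & f y = x.

Lemma balanced_inj s : balanced s ->
  forall x, x \in lin_span [set` s] -> f x = 0 -> x = 0.
Proof.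
move=> bal _ /lin_span_lincomb[c ->]; apply: lincomb_surj_inj => {}c.
  apply/lin_span_lincomb; apply: (lin_span_image (P := [set` s])) => [x /bal[]//|].
  by apply/lin_span_lincomb; exists c.
have cs : lincomb (tnth (in_tuple s)) c \in lin_span [set` s].
  by apply/lin_span_lincomb; exists c.
have [y] : exists2 y, y \in lin_span [set` s]
    & f y = lincomb (tnth (in_tuple s)) c.
  by apply: lin_span_preimage cs => x /bal[].
by case/lin_span_lincomb=> d -> <-; exists d.
Qed.

Lemma balanced_cat s t : balanced s -> balanced t -> balanced (s ++ t).
Proof.
have sub (u v : seq M) x : {subset u <= v} ->
    x \in lin_span [set` u] -> x \in lin_span [set` v].
  by move=> uv; move: x; apply: lin_spanS => x /uv; apply: mem_lin_span.
have subl : {subset s <= s ++ t} by move=> x; rewrite mem_cat => ->.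
have subr : {subset t <= s ++ t} by move=> x; rewrite mem_cat => ->; rewrite orbT.
move=> bs bt x; rewrite mem_cat => /orP[/bs|/bt] [fx [y ys fy]].
- by split; [apply: sub fx|exists y => //; apply: sub ys].
- by split; [apply: sub fx|exists y => //; apply: sub ys].
Qed.

End SurjectiveEndomorphism.

(** * Graded maps between tensor algebras *)

Section TensorMaps.
Variable k : fieldType.

Lemma eq_tens_linear (U W X : lmodType k) (f g : {linear tens U W -> X}) :
  (forall u w, f (u ⊗ w) = g (u ⊗ w)) -> f =1 g.
Proof.
move=> fg; apply: tens_ind => [|x y hx hy|a u w]; first by rewrite !linear0.
  by rewrite !linearD hx hy.
by rewrite !linearZ fg.
Qed.

Lemma tens_map_can (U W U' W' : lmodType k) (f : {linear U -> U'})
    (g : {linear W -> W'}) (f' : {linear U' -> U}) (g' : {linear W' -> W}) :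
  cancel f f' -> cancel g g' -> cancel (tens_map f g) (tens_map f' g').
Proof.
move=> fK gK.
apply: (eq_tens_linear (f := tens_map f' g' \o tens_map f g) (g := idfun)).
by move=> u w; rewrite /= !tens_mapE fK gK.
Qed.

End TensorMaps.

Section Graded.
Variable k : fieldType.
Implicit Types V W : lmodType k.

Lemma eq_talg_morphism V (A : ualgType k) (f g : {linear talg V -> A}) :
  alg_morphism f -> alg_morphism g ->
  (forall v, f (tvec v) = g (tvec v)) -> f =1 g.
Proof.
move=> [f1 fM] [g1 gM] fg; apply: (ta_generated (t := tensor_algebra_of V)) => //.
split=> [|a x y hx hy|x y hx hy]; first by rewrite f1 g1.
  by rewrite !linearP hx hy.
by rewrite fM gM hx hy.
Qed.

Lemma tpow0_one V : (uone : talg V) \in tpow 0.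
Proof. by apply: mem_lin_span; exists [::] => //; rewrite big_nil. Qed.

Lemma tpow1_tvec V (v : V) : tvec v \in tpow 1.
Proof. by apply: mem_lin_span; exists [:: v] => //; rewrite big_seq1. Qed.

Lemma tpowM V r s (x y : talg V) :
  x \in tpow r -> y \in tpow s -> x ** y \in tpow (r + s).
Proof.
move=> hx hy; move: x hx.
apply: lin_span_ind => [|x x' hx hx'|a _ [u /= ur <-]].
- by rewrite umul0x rpred0.
- by rewrite umulDl rpredD.
rewrite umulZl rpredZ //; move: y hy.
apply: lin_span_ind => [|y y' hy hy'|b _ [t /= ts <-]].
- by rewrite umulx0 rpred0.
- by rewrite umulDr rpredD.
by rewrite umulZr rpredZ // -big_cat -ur -ts -size_cat tpow_word.
Qed.

Lemma mem_bitpow V r s (x y : talg V) :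
  x \in tpow r -> y \in tpow s -> x ⊗ y \in bitpow r s.
Proof. by move=> hx hy; apply: mem_lin_span; exists x, y. Qed.

Lemma umult_bitpow V r s (w : tens (talg V) (talg V)) :
  w \in bitpow r s -> umult w \in tpow (r + s).
Proof.
apply: lin_span_image => _ [x [y [hx hy ->]]].
by rewrite umultE; apply: tpowM.
Qed.

Definition graded V W (f : {linear talg V -> talg W}) :=
  forall r x, x \in tpow r -> f x \in tpow r.

Definition bigraded V W
    (f : {linear tens (talg V) (talg V) -> tens (talg W) (talg W)}) :=
  forall r s w, w \in bitpow r s -> f w \in bitpow r s.

Lemma tens_map_bigraded V W (f : {linear talg V -> talg W}) :
  graded f -> bigraded (tens_map f f).
Proof.
move=> fg r s; apply: lin_span_image => _ [x [y [hx hy ->]]].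
by rewrite tens_mapE; apply: mem_bitpow; apply: fg.
Qed.

Lemma tens_map_bitpow_surj V W (f : {linear talg V -> talg W}) r s :
  (forall y, y \in tpow r -> exists2 x, x \in tpow r & f x = y) ->
  (forall y, y \in tpow s -> exists2 x, x \in tpow s & f x = y) ->
  forall w, w \in bitpow r s -> exists2 u, u \in bitpow r s & tens_map f f u = w.
Proof.
move=> fr fs; apply: lin_span_preimage => _ [_ [_ [/fr[x xr <-] /fs[y ys <-] ->]]].
by exists (x ⊗ y); rewrite ?tens_mapE // mem_bitpow.
Qed.

(** The componentwise equality in the definition of a cochain says that the
    inverse is bigraded too, which is the form used below. *)
Lemma Z2_inverse V (psi : {linear tens (talg V) (talg V) -> tens (talg V) (talg V)}) :
  Z2 psi -> exists psi' : {linear tens (talg V) (talg V) -> tens (talg V) (talg V)},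
    [/\ cancel psi psi', cancel psi' psi, bigraded psi & bigraded psi'].
Proof.
case=> -[/linear_inverse[psi' psiK psiK'] im] _ _.
exists psi'; split=> // r s w wrs.
- have : (psi @` [set` bitpow r s]) (psi w) by exists w.
  by rewrite im.
- have : [set` bitpow r s] w by [].
  by rewrite -im => -[u urs <-]; rewrite psiK.
Qed.

Definition talg_map V W (f : {linear V -> W}) : {linear talg V -> talg W} :=
  talg_lift (tvec \o f).

Lemma talg_map_morphism V W (f : {linear V -> W}) : alg_morphism (talg_map f).
Proof. exact: talg_lift_morphism. Qed.

Lemma talg_mapE V W (f : {linear V -> W}) v : talg_map f (tvec v) = tvec (f v).
Proof. exact: talg_liftE. Qed.

Lemma talg_map_graded V W (f : {linear V -> W}) : graded (talg_map f).
Proof.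
have [f1 fM] := talg_map_morphism f.
move=> r; apply: lin_span_image => _ [s /= <- <-].
have -> : talg_map f (\uprod_(v <- s) tvec v) = \uprod_(v <- map f s) tvec v.
  by rewrite (big_morph _ fM f1) big_map; apply: eq_bigr => v _; apply: talg_mapE.
by rewrite -(size_map f s); apply: tpow_word.
Qed.

Lemma talg_map_can V W (f : {linear V -> W}) (g : {linear W -> V}) :
  cancel f g -> cancel (talg_map f) (talg_map g).
Proof.
have [f1 fM] := talg_map_morphism f; have [g1 gM] := talg_map_morphism g.
move=> fK; apply: (eq_talg_morphism (f := talg_map g \o talg_map f) (g := idfun)).
- by split=> [|x y] /=; rewrite ?f1 ?g1 ?fM ?gM.
- by split.
- by move=> v; rewrite /= !talg_mapE fK.
Qed.

Lemma tpow_finite V r : (exists s : seq V, forall v, v \in lin_span [set` s]) ->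
  exists2 L : seq (talg V), {subset L <= tpow r}
    & forall x, x \in tpow r -> x \in lin_span [set` L].
Proof.
case=> s hs; elim: r => [|r [L Lr hL]].
  exists [:: uone] => [x|]; first by rewrite inE => /eqP ->; apply: tpow0_one.
  apply: lin_spanS => _ [t /size0nil -> <-]; rewrite big_nil.
  by apply: mem_lin_span => /=; rewrite inE.
exists [seq tvec v ** x | v <- s, x <- L].
  move=> _ /allpairsP[[v x] /= [_ /Lr xr ->]].
  exact: (tpowM (r := 1) (tpow1_tvec v) xr).
apply: lin_spanS => _ [[//|v t] /= [tr] <-].
rewrite big_cons; set x := \big[_/_]_(_ <- _) _.
have : x \in lin_span [set` L] by apply: hL; rewrite -tr tpow_word.
move: x; apply: lin_span_ind => [|x y hx hy|a x xL].
- by rewrite umulx0 rpred0.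
- by rewrite umulDr rpredD.
rewrite umulZr rpredZ //; move: v (hs v).
apply: lin_span_ind => [|v w hv hw|b v vs].
- by rewrite linear0 umul0x rpred0.
- by rewrite linearD umulDl rpredD.
rewrite linearZ umulZl rpredZ //; apply: mem_lin_span.
exact: (allpairs_f _ vs xL).
Qed.

End Graded.

Lemma gens_finite (k : fieldType) (A : quantum_space k) :
  exists s : seq (gens A), forall v, v \in lin_span [set` s].
Proof.
have [s sE] := qs_gen_finite A.
exists (pmap insub s) => v.
have : \val v \in lin_span [set` s] by rewrite -sE; apply: valP.
case/asboolP=> t ts vt; apply/asboolP.
exists [seq (p.1, insubd 0 p.2) | p <- t].
  move=> _ /mapP[p /ts ps ->] /=.
  by rewrite mem_pmap_sub val_insubd sE mem_lin_span.
apply: val_inj; rewrite vt big_map raddf_sum /= big_seq [RHS]big_seq.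
apply: eq_bigr => p /ts ps /=.
by rewrite val_insubd sE mem_lin_span.
Qed.

(** * The twisted tensor algebra *)

Definition twisted_talg (k : fieldType) (A : quantum_space k)
    (psi : {linear tens (talg (gens A)) (talg (gens A)) ->
                   tens (talg (gens A)) (talg (gens A))}) of Z2 psi : Type :=
  talg (gens A).

Section TwistedTensorAlgebra.
Variables (k : fieldType) (A : quantum_space k).
Local Notation T := (talg (gens A)).
Variables (psi : {linear tens T T -> tens T T}) (psiZ : Z2 psi).

Definition talg_twist_mul (x y : T) : T := umult (psi (x ⊗ y)).

Fact talg_twist_1x : left_id uone talg_twist_mul.
Proof.
move=> x; case: psiZ => _ _ /(_ x)[h _].
by rewrite /talg_twist_mul h umultE umul1x.
Qed.

Fact talg_twist_x1 : right_id uone talg_twist_mul.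
Proof.
move=> x; case: psiZ => _ _ /(_ x)[_ h].
by rewrite /talg_twist_mul h umultE umulx1.
Qed.

Fact talg_twist_A : associative talg_twist_mul.
Proof. by move=> x y z; rewrite /talg_twist_mul (cocycle2_all psiZ). Qed.

Fact talg_twist_linearl y : linear (talg_twist_mul^~ y).
Proof. by move=> a x x'; rewrite /talg_twist_mul pureDl pureZl !linearP. Qed.

Fact talg_twist_linearr x : linear (talg_twist_mul x).
Proof. by move=> a y y'; rewrite /talg_twist_mul pureDr pureZr !linearP. Qed.

HB.instance Definition _ := GRing.Lmodule.on (twisted_talg psiZ).
HB.instance Definition _ :=
  Lmodule_isUnitalAlgebra.Build k (twisted_talg psiZ)
    talg_twist_A talg_twist_1x talg_twist_x1
    talg_twist_linearl talg_twist_linearr.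

(** The gauge transformation whose coboundary is [psi]; its bijectivity is the
    heart of the proof. *)
Definition theta : {linear T -> T} :=
  talg_lift ((tvec : {linear gens A -> T}) : {linear gens A -> twisted_talg psiZ}).

Lemma theta1 : theta uone = uone.
Proof. exact: (talg_lift_morphism (A := twisted_talg psiZ) _).1. Qed.

Lemma thetaM x y : theta (x ** y) = umult (psi (theta x ⊗ theta y)).
Proof. exact: (talg_lift_morphism (A := twisted_talg psiZ) _).2. Qed.

Lemma thetaE v : theta (tvec v) = tvec v.
Proof. exact: (talg_liftE (A := twisted_talg psiZ)). Qed.

Lemma theta_umult w : theta (umult w) = umult (psi (tens_map theta theta w)).
Proof.
move: w; apply: (eq_tens_linear (f := theta \o umult)
  (g := umult \o (psi \o tens_map theta theta))) => x y /=.
by rewrite umultE thetaM tens_mapE.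
Qed.

Lemma theta_graded : graded theta.
Proof.
have [_ [_ _ psi_bi _]] := Z2_inverse psiZ.
have one x : x \in tpow 1 -> theta x \in tpow 1.
  apply: lin_span_image => _ [[|v [|//]] // _ <-].
  by rewrite big_seq1 thetaE tpow1_tvec.
elim=> [|r IHr].
  apply: lin_span_image => _ [s /size0nil -> <-].
  by rewrite big_nil theta1; apply: tpow0_one.
move=> x /tpowM_span; apply: lin_span_image => _ [y [z [yr z1 ->]]].
rewrite thetaM -addn1; apply/umult_bitpow/psi_bi/mem_bitpow; first exact: IHr.
exact: one.
Qed.

(** A product [y z] with [z] of degree 1 is [m psi] of the element
    [psi^-1 (y ⊗ z)], again of bidegree [(r, 1)]; by induction the latter is the
    image under [theta ⊗ theta] of some [w], and then [theta (m w) = y z]. *)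
Lemma theta_tpow_surj r x : x \in tpow r -> exists2 y, y \in tpow r & theta y = x.
Proof.
have [psi' [_ psiK' _ psi'_bi]] := Z2_inverse psiZ.
have one : forall x, x \in tpow 1 -> exists2 y, y \in tpow 1 & theta y = x.
  apply: lin_span_preimage => _ [[|v [|//]] // _ <-].
  by exists (tvec v); rewrite ?tpow1_tvec // big_seq1 thetaE.
elim: r x => [|r IHr].
  apply: lin_span_preimage => _ [s /size0nil -> <-].
  by exists uone; rewrite ?tpow0_one // big_nil theta1.
move=> x /tpowM_span; move: x; apply: lin_span_preimage => _ [y [z [yr z1 ->]]].
have := psi'_bi _ _ _ (mem_bitpow yr z1).
case/(tens_map_bitpow_surj IHr one) => w wr thw.
exists (umult w); first by rewrite -addn1 umult_bitpow.
by rewrite theta_umult thw psiK' umultE.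
Qed.

Lemma theta_balanced x :
  exists2 s, balanced theta s & x \in lin_span [set` s].
Proof.
move: x; apply: talg_ind => [|x y [s bs xs] [t bt yt]|r x xr].
- by exists [::]; rewrite ?rpred0.
- exists (s ++ t); first exact: balanced_cat.
  have sub (u : seq T) z : {subset u <= s ++ t} -> z \in lin_span [set` u] ->
      z \in lin_span [set` s ++ t].
    by move=> us; move: z; apply: lin_spanS => z /us; apply: mem_lin_span.
  by rewrite rpredD // ?(sub _ _ _ xs) ?(sub _ _ _ yt) // => z zs;
     rewrite mem_cat zs ?orbT.
have [s sr rs] := tpow_finite r (gens_finite A).
exists s; last exact: rs.
move=> y /sr yr; split; first exact/rs/theta_graded.
by have [z zr zy] := theta_tpow_surj yr; exists z; first exact: rs.
Qed.

(** Injectivity uses that the generating space is finite-dimensional: every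
    difference [x - y] lies in a finite-dimensional subspace that [theta] maps
    onto itself. *)
Lemma theta_bij : bijective theta.
Proof.
have inj : injective theta.
  move=> x y /eqP; rewrite -subr_eq0 -linearB => /eqP th0.
  have [s bs xys] := theta_balanced (x - y).
  by apply/eqP; rewrite -subr_eq0 (balanced_inj bs xys th0).
have sur x : exists y, theta y = x.
  move: x; apply: talg_ind => [|_ _ [x <-] [y <-]|r x /theta_tpow_surj[y _ <-]].
  - by exists 0; rewrite linear0.
  - by exists (x + y); rewrite linearD.
  - by exists y.
have [eta etaK] := choice sur.
by exists eta => // x; apply: inj; rewrite etaK.
Qed.

Lemma theta_inverse : exists eta : {linear T -> T},
  [/\ cancel theta eta, cancel eta theta & graded eta].
Proof.
have [eta thK etaK] := linear_inverse theta_bij.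
by exists eta; split=> // r _ /theta_tpow_surj[x xr <-]; rewrite thK.
Qed.

End TwistedTensorAlgebra.

(** * Gauge transformations between quantum spaces *)

(** A description of twist relatedness that is stable under inversion and
    composition.  The cocycle condition on [g_psi] is a consequence of [g_liftM],
    and compatibility of [g_lin] with the generating subspaces is a consequence of
    [g_Pi] and the grading.  Inverses are stored explicitly so that every condition
    is an inclusion or an equation between linear maps. *)
Record gauge (k : fieldType) (A B : quantum_space k) := Gauge {
  g_lin : {linear A -> B};
  g_lin' : {linear B -> A};
  g_lift : {linear talg (gens A) -> talg (gens B)};
  g_lift' : {linear talg (gens B) -> talg (gens A)};
  g_psi : {linear tens (talg (gens A)) (talg (gens A)) ->
                  tens (talg (gens A)) (talg (gens A))};
  g_psi' : {linear tens (talg (gens A)) (talg (gens A)) ->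
                   tens (talg (gens A)) (talg (gens A))};
  g_linK : cancel g_lin g_lin';
  g_linK' : cancel g_lin' g_lin;
  g_liftK : cancel g_lift g_lift';
  g_liftK' : cancel g_lift' g_lift;
  g_psiK : cancel g_psi g_psi';
  g_psiK' : cancel g_psi' g_psi;
  g_lift_graded : graded g_lift;
  g_lift'_graded : graded g_lift';
  g_psi_bigraded : bigraded g_psi;
  g_psi'_bigraded : bigraded g_psi';
  g_psi_counital : counital g_psi;
  g_psi_ker : forall w, ker_Pi2 w -> ker_Pi2 (g_psi w);
  g_psi'_ker : forall w, ker_Pi2 w -> ker_Pi2 (g_psi' w);
  g_Pi : forall x, Pi (g_lift x) = g_lin (Pi x);
  g_liftM : forall x y, g_lift (umult (g_psi (x ⊗ y))) = g_lift x ** g_lift y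
}.

Section GaugeTheory.
Variable k : fieldType.
Implicit Types A B C : quantum_space k.

Lemma g_lift_umult A B (g : gauge A B) w :
  g_lift g (umult (g_psi g w)) = umult (tens_map (g_lift g) (g_lift g) w).
Proof.
move: w; apply: (eq_tens_linear (f := g_lift g \o (umult \o g_psi g))
  (g := umult \o tens_map (g_lift g) (g_lift g))) => x y /=.
by rewrite g_liftM tens_mapE umultE.
Qed.

Lemma g_psi'_counital A B (g : gauge A B) : counital (g_psi' g).
Proof.
move=> a; have [l r] := g_psi_counital g a.
by split; [rewrite -{1}l|rewrite -{1}r]; rewrite g_psiK.
Qed.

(** By counitality [g_lift y = g_lift 1 ** g_lift y]; taking for [y] the preimage
    of the unit gives the claim. *)
Lemma g_lift1 A B (g : gauge A B) : g_lift g uone = uone.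
Proof.
have := g_liftM g uone (g_lift' g uone).
rewrite (g_psi_counital g _).1 umultE umul1x g_liftK'.
by rewrite umulx1.
Qed.

Lemma g_lift'1 A B (g : gauge A B) : g_lift' g uone = uone.
Proof. by rewrite -(g_lift1 g) g_liftK. Qed.

Lemma g_Pi' A B (g : gauge A B) x : Pi (g_lift' g x) = g_lin' g (Pi x).
Proof. by rewrite -[in RHS](g_liftK' g x) g_Pi g_linK. Qed.

(** Transports admissibility between the two quantum spaces. *)
Lemma ker_Pi2_tens_map A B (f : {linear A -> B})
    (F : {linear talg (gens A) -> talg (gens B)}) :
  (forall x, Pi (F x) = f (Pi x)) ->
  forall w, ker_Pi2 w -> ker_Pi2 (tens_map F F w).
Proof.
move=> Ff w w0; rewrite /ker_Pi2 /=.
have -> : tens_map Pi Pi (tens_map F F w) = tens_map f f (tens_map Pi Pi w).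
  move: w {w0}; apply: (eq_tens_linear (f := tens_map Pi Pi \o tens_map F F)
    (g := tens_map f f \o tens_map Pi Pi)) => x y /=.
  by rewrite !tens_mapE !Ff.
by rewrite [X in tens_map f f X]w0 linear0.
Qed.

Lemma gauge_refl A : gauge A A.
Proof.
apply: (@Gauge k A A idfun idfun idfun idfun idfun idfun) => //.
by move=> x y; rewrite /= umultE.
Qed.

(** The new cochain satisfies [m psi1 = tau m (tau ⊗ tau)^-1], the coboundary of
    the inverse lift. *)
Lemma gauge_sym A B : gauge A B -> gauge B A.
Proof.
move=> g.
pose t := tens_map (g_lift g) (g_lift g).
pose t' := tens_map (g_lift' g) (g_lift' g).
have tK : cancel t t' by apply: tens_map_can; apply: g_liftK.
have tK' : cancel t' t by apply: tens_map_can; apply: g_liftK'.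
have tbi : bigraded t by apply/tens_map_bigraded/g_lift_graded.
have t'bi : bigraded t' by apply/tens_map_bigraded/g_lift'_graded.
have tker := ker_Pi2_tens_map (g_Pi g).
have t'ker := ker_Pi2_tens_map (g_Pi' g).
apply: (@Gauge k B A (g_lin' g) (g_lin g) (g_lift' g) (g_lift g)
  (t \o (g_psi' g \o t')) (t \o (g_psi g \o t'))).
- exact: g_linK'.
- exact: g_linK.
- exact: g_liftK'.
- exact: g_liftK.
- by move=> w; rewrite /= tK g_psiK' tK'.
- by move=> w; rewrite /= tK g_psiK tK'.
- exact: g_lift'_graded.
- exact: g_lift_graded.
- by move=> r s w wrs; apply/tbi/g_psi'_bigraded/t'bi.
- by move=> r s w wrs; apply/tbi/g_psi_bigraded/t'bi.
- move=> a; have [l r] := g_psi'_counital g (g_lift' g a).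
  by split; rewrite /= /t' tens_mapE g_lift'1 ?l ?r /t tens_mapE g_lift1 g_liftK'.
- by move=> w w0; apply/tker/g_psi'_ker/t'ker.
- by move=> w w0; apply/tker/g_psi_ker/t'ker.
- exact: g_Pi'.
move=> x y; rewrite /= /t -g_lift_umult g_psiK' g_liftK.
by rewrite /t' tens_mapE umultE.
Qed.

(** The second cochain, conjugated back to the first tensor algebra, followed by
    the first one. *)
Lemma gauge_trans A B C : gauge A B -> gauge B C -> gauge A C.
Proof.
move=> g h.
pose t := tens_map (g_lift g) (g_lift g).
pose t' := tens_map (g_lift' g) (g_lift' g).
have tK : cancel t t' by apply: tens_map_can; apply: g_liftK.
have tK' : cancel t' t by apply: tens_map_can; apply: g_liftK'.
have tbi : bigraded t by apply/tens_map_bigraded/g_lift_graded.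
have t'bi : bigraded t' by apply/tens_map_bigraded/g_lift'_graded.
have tker := ker_Pi2_tens_map (g_Pi g).
have t'ker := ker_Pi2_tens_map (g_Pi' g).
apply: (@Gauge k A C (g_lin h \o g_lin g) (g_lin' g \o g_lin' h)
  (g_lift h \o g_lift g) (g_lift' g \o g_lift' h)
  (g_psi g \o (t' \o (g_psi h \o t))) (t' \o (g_psi' h \o (t \o g_psi' g)))).
- by move=> x; rewrite /= !g_linK.
- by move=> x; rewrite /= !g_linK'.
- by move=> x; rewrite /= !g_liftK.
- by move=> x; rewrite /= !g_liftK'.
- by move=> w; rewrite /= g_psiK tK' g_psiK tK.
- by move=> w; rewrite /= tK' g_psiK' tK g_psiK'.
- by move=> r x xr; apply/g_lift_graded/g_lift_graded.
- by move=> r x xr; apply/g_lift'_graded/g_lift'_graded.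
- by move=> r s w wrs; apply/g_psi_bigraded/t'bi/g_psi_bigraded/tbi.
- by move=> r s w wrs; apply/t'bi/g_psi'_bigraded/tbi/g_psi'_bigraded.
- move=> a; have [l r] := g_psi_counital h (g_lift g a).
  have [l' r'] := g_psi_counital g a.
  by split; rewrite /= /t tens_mapE g_lift1 ?l ?r /t' tens_mapE g_lift'1 g_liftK.
- by move=> w w0; apply/g_psi_ker/t'ker/g_psi_ker/tker.
- by move=> w w0; apply/t'ker/g_psi'_ker/tker/g_psi'_ker.
- by move=> x; rewrite /= !g_Pi.
by move=> x y; rewrite /= g_lift_umult -/t tK' /t tens_mapE g_liftM.
Qed.

End GaugeTheory.

(** * Twist relatedness and gauge transformations *)

Section GaugeTwist.
Variable k : fieldType.
Implicit Types A B C : quantum_space k.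

Lemma Pi_tpow1 A x : x \in tpow 1 -> Pi x \in qs_gen A.
Proof.
move: x; apply: lin_span_ind => [|x y hx hy|a _ [[|v [|//]] // _ <-]].
- by rewrite linear0 rpred0.
- by rewrite linearD rpredD.
by rewrite linearZ rpredZ // big_seq1 PiE; apply: valP.
Qed.

Lemma restrict_gens A B (f : {linear A -> B}) :
  (forall x, x \in qs_gen A -> f x \in qs_gen B) ->
  exists f1 : {linear gens A -> gens B}, forall v, \val (f1 v) = f (\val v).
Proof.
move=> fgen.
pose f1 (v : gens A) : gens B := exist _ (f (\val v)) (fgen _ (valP v)).
have lin : linear f1 by move=> a x y; apply: val_inj; rewrite /= linearP.
pose F := HB.pack_for {linear gens A -> gens B} f1
  (GRing.isLinear.Build k _ _ _ f1 lin).
by exists F.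
Qed.

(** Both sides of the cocycle identity become
    [(g_lift x ** g_lift y) ** g_lift z] under the injective [g_lift]. *)
Lemma gauge_twist_related A B : gauge A B -> twist_related A B.
Proof.
move=> g.
have liftM := g_lift_umult g.
have adm : admissible (g_psi g).
  apply/seteqP; split=> [_ [w w0 <-]|w w0]; first exact: g_psi_ker.
  by exists (g_psi' g w); [apply: g_psi'_ker|apply: g_psiK'].
have Z : Z2 (g_psi g).
  split; last exact: g_psi_counital.
  - split; first by exists (g_psi' g); [apply: g_psiK|apply: g_psiK'].
    move=> r s; apply/seteqP; split=> [_ [w wrs <-]|w wrs].
      exact: g_psi_bigraded.
    by exists (g_psi' g w); [apply: g_psi'_bigraded|apply: g_psiK'].
  move=> r s t x y z _ _ _; apply: (can_inj (g_liftK g)).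
  by rewrite !g_liftM umulA.
exists (g_psi g), adm, Z.
exists (g_lin g : {linear (twisting adm Z) -> B}),
       (g_lin' g : {linear B -> (twisting adm Z)}).
have f1 : g_lin g uone = uone by rewrite -Pi1 -g_Pi g_lift1 Pi1.
have fM (x y : A) : g_lin g (twist_mul (g_psi g) x y) = g_lin g x ** g_lin g y.
  have [u <-] := Pi_surj x; have [v <-] := Pi_surj y.
  by rewrite twist_mulE // -!g_Pi g_liftM PiM.
have f1' : g_lin' g uone = uone by rewrite -f1 g_linK.
have fM' x y : g_lin' g (x ** y) = twist_mul (g_psi g) (g_lin' g x) (g_lin' g y).
  by rewrite -[RHS](g_linK g) fM !g_linK'.
have genP (D : quantum_space k) (x : D) (xD : x \in qs_gen D) :
    x = Pi (tvec (exist _ x xD : gens D)) by rewrite PiE.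
split.
- split; first by split.
  move=> x xA; rewrite (genP A x xA) -g_Pi.
  exact/Pi_tpow1/g_lift_graded/tpow1_tvec.
- split; first by split.
  move=> x xB; rewrite (genP B x xB) -g_Pi'.
  exact/Pi_tpow1/g_lift'_graded/tpow1_tvec.
- exact: (g_linK g).
- exact: (g_linK' g).
Qed.

(** The lift is [theta^-1] followed by [talg_map] of the restriction of [f] to
    generators.  It covers [f] because [Pi (theta x)], read in the twisting of [A],
    is the canonical projection of that quantum space. *)
Lemma twist_related_gauge A B : twist_related A B -> inhabited (gauge A B).
Proof.
case=> psi [adm [Z [f [f' [[[f1 fM] fgen] [_ f'gen] fK f'K]]]]].
have [F Fval] := restrict_gens (A := A) (f := f) fgen.
have [F' F'val] := restrict_gens (B := A) (f := f') f'gen.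
have FK : cancel F F' by move=> v; apply: val_inj; rewrite F'val Fval fK.
have F'K : cancel F' F by move=> v; apply: val_inj; rewrite Fval F'val f'K.
have [psi' [psiK psiK' psi_bi psi'_bi]] := Z2_inverse Z.
have [eta [thK etaK eta_gr]] := theta_inverse Z.
(* both sides are algebra morphisms out of a tensor algebra *)
have PiF x : Pi (talg_map F x) = f (Pi (theta Z x)).
  have [m1 mM] := talg_map_morphism F.
  move: x; apply: (eq_talg_morphism (f := Pi \o talg_map F)
    (g := (f : {linear A -> B}) \o (Pi \o theta Z))).
  - by split=> [|x y] /=; rewrite ?m1 ?mM ?Pi1 ?PiM.
  - split=> [|x y] /=; first by rewrite theta1 Pi1.
    by rewrite thetaM -(twist_mulE adm) fM.
  - by move=> v; rewrite /= talg_mapE thetaE !PiE Fval.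
constructor; apply: (@Gauge k A B (f : {linear A -> B}) (f' : {linear B -> A})
  (talg_map F \o eta) (theta Z \o talg_map F') psi psi') => //.
- by move=> x; rewrite /= talg_map_can // etaK.
- by move=> x; rewrite /= thK talg_map_can.
- by move=> r x xr; apply/talg_map_graded/eta_gr.
- by move=> r x xr; apply/theta_graded/talg_map_graded.
- by have [_ _ cu] := Z.
- by move=> w w0; rewrite -adm; exists w.
- by move=> w; rewrite -{1}adm => -[u u0 <-]; rewrite psiK.
- by move=> x; rewrite /= PiF etaK.
move=> x y; have [_ mM] := talg_map_morphism F.
by rewrite /= -mM -[x in LHS]etaK -[y in LHS]etaK -thetaM thK.
Qed.

End GaugeTwist.

Theorem twist_related_equivalence (k : fieldType) : Equivalence (@twist_related k).
Proof.
split=> [A|A B|A B C].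
- exact/gauge_twist_related/gauge_refl.
- by case/twist_related_gauge=> g; apply/gauge_twist_related/gauge_sym.
- case/twist_related_gauge=> g /twist_related_gauge[h].
  exact/gauge_twist_related/(gauge_trans g h).
Qed.

Theorem proposition15 (R : realType) :
  Equivalence (@twist_related R) /\ Equivalence (@twist_related (complex R)).
Proof. by split; apply: twist_related_equivalence. Qed.
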